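(* Let $A\in\mathbb{R}_{\max}^{d\times d}$ be irreducible and let $\mathcal{G}$ be a strongly connected subgraph of $\mathcal{G}(A)$ (containing at least one cycle). Then $$T_{cr}^{\sigma}(A,\mathcal{G})\le \sigma\left\lfloor\frac{d}{\gamma}\right\rfloor+d-\sigma-1,$$ where $\gamma$ is the cyclicity of $\mathcal{G}(A)$ and $\sigma$ is the cyclicity of $\mathcal{G}$.
   Context: $\mathbb{R}_{\max}=\mathbb{R}\cup\{-\infty\}$. For $A\in\mathbb{R}_{\max}^{d\times d}$, $\mathcal{G}(A)$ is the digraph with nodes $1,\dots,d$ and an arc $(i,j)$ whenever $a_{ij}\neq-\infty$. The length $l(W)$ of a walk $W$ is its number of arcs. A cycle is a closed walk with at least one arc and no repeated node other than its coinciding ends. $A$ is irreducible if $\mathcal{G}(A)$ is strongly connected. The cyclicity of a strongly connected digraph is the gcd of the lengths of its cycles. Cycle removal threshold: for a subgraph $\mathcal{G}$ of $\mathcal{G}(A)$ and a positive integer $\sigma$, $T_{cr}^{\sigma}(A,\mathcal{G})$ is the smallest nonnegative integer $T$ such that: for all nodes $i,j$ and each walk $W$ on $\mathcal{G}(A)$ from $i$ to $j$ that goes through a node of $\mathcal{G}$ and has length $\ge T$, there is a walk $V$ from $i$ to $j$ going through a node of $\mathcal{G}$, obtained from $W$ by removing cycles and possibly inserting cycles of $\mathcal{G}$, such that $l(V)\equiv l(W)\pmod\sigma$ and $l(V)\le T$. *)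

(* Defs.v *)
From Stdlib Require Import Relation_Operators.
From HB Require Import structures.
From mathcomp Require Import all_boot all_order all_algebra.
From mathcomp Require Import reals constructive_ereal.
Set Implicit Arguments.
Unset Strict Implicit.
Unset Printing Implicit Defensive.

Definition Rmax (R : realType) := {x : \bar R | x != +oo%E}.

Record digraph (V : finType) := Digraph {
  nodes : {set V};
  arcs : rel V;
  arcs_nodes : forall i j, arcs i j -> (i \in nodes) && (j \in nodes)
}.

Definition subgraph (V : finType) (G H : digraph V) :=
  nodes G \subset nodes H /\ subrel (arcs G) (arcs H).

Definition strongly_connected (V : finType) (D : digraph V) :=
  {in nodes D &, forall i j, connect (arcs D) i j}.

(* The walk i -> p_1 -> ... -> p_l is given by its first node i and the
   sequence p of its remaining nodes; its length is [size p], and p = [::] is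
   the walk of length 0 at i. *)
Definition is_walk (V : finType) (D : digraph V) (i : V) (p : seq V) (j : V) :=
  [&& i \in nodes D, path (arcs D) i p & last i p == j].

(* The first node of a closed walk is also its last one, hence already in p:
   [uniq p] says that only the two ends coincide. *)
Definition is_cycle (V : finType) (D : digraph V) (i : V) (p : seq V) :=
  [&& is_walk D i p i, p != [::] & uniq p].

(* A cycle has at most #|V| arcs, so all cycles are among the sequences of
   length at most #|V|; see [cyclicityP]. *)
Definition cyclicity (V : finType) (D : digraph V) : nat :=
  \big[gcdn/0%N]_(p : #|V|.-bseq V | [exists i, is_cycle D i p]) size p.

Lemma cyclicityP (V : finType) (D : digraph V) (g : nat) :
  g %| cyclicity D <-> forall i p, is_cycle D i p -> g %| size p.
Proof.
rewrite /cyclicity; split=> [gD i p Dp | gD].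
  have up : size p <= #|V|.
    by case/and3P: Dp => _ _ /card_uniqP <-; exact: max_card.
  apply: (dvdn_trans gD).
  have PD : [exists i0, is_cycle D i0 (Bseq up)] by apply/existsP; exists i.
  by rewrite (bigD1 (Bseq up)) //= dvdn_gcdl.
apply: (big_ind (fun m => g %| m)) => [|m n gm gn|p /existsP[i Dp]].
- exact: dvdn0.
- by rewrite dvdn_gcd gm.
- exact: gD Dp.
Qed.

Definition cycle_removal (V : finType) (D : digraph V) (i : V) (p q : seq V) :=
  exists p1 c p2,
    [/\ p = p1 ++ c ++ p2, is_cycle D (last i p1) c & q = p1 ++ p2].

Definition cycle_insertion (V : finType) (D : digraph V) (i : V)
    (p q : seq V) :=
  cycle_removal D i q p.

(* First any number of removals of cycles of D (possibly none), then any number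
   of insertions of cycles of G. *)
Definition obtained_from (V : finType) (D G : digraph V) (i : V)
    (p q : seq V) :=
  exists r, clos_refl_trans _ (cycle_removal D i) p r /\
            clos_refl_trans _ (cycle_insertion G i) r q.

Definition goes_through (V : finType) (G : digraph V) (i : V) (p : seq V) :=
  has (mem (nodes G)) (i :: p).

Section MaxPlus.
Context {R : realType} {d : nat}.
Implicit Types (A : 'M[Rmax R]_d) (G : digraph 'I_d).

Lemma mx_arcs_nodes A (i j : 'I_d) :
  val (A i j) != -oo%E -> (i \in [set: 'I_d]) && (j \in [set: 'I_d]).
Proof. by rewrite !inE. Qed.

Definition mx_digraph A : digraph 'I_d := Digraph (@mx_arcs_nodes A).

Definition irreducible A := strongly_connected (mx_digraph A).

Definition cycle_removal_bound (sigma : nat) A G (T : nat) :=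
  forall (i j : 'I_d) (p : seq 'I_d),
    is_walk (mx_digraph A) i p j -> goes_through G i p -> T <= size p ->
    exists q : seq 'I_d,
      [/\ is_walk (mx_digraph A) i q j, goes_through G i q,
          obtained_from (mx_digraph A) G i p q,
          size q = size p %[mod sigma] & size q <= T].

Definition is_cycle_removal_threshold (sigma : nat) A G (T : nat) :=
  cycle_removal_bound sigma A G T /\
  forall T', cycle_removal_bound sigma A G T' -> T <= T'.

End MaxPlus.

(* Main.v *)
(** Removing cycles suffices. Let sigma = t * gamma, and cut a walk W at the
    first node k of G that it meets. The visits of W to a node m are pairwise
    congruent modulo gamma. Hence, among t + 1 visits on the same side of k, two
    are congruent modulo sigma, and the closed walk between them can be removed.
    Gluing the part of W up to its last visit to m before k with the part from
    its first visit to m after k shows that t + 2 visits on both sides of k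
    always allow a removal of total length divisible by sigma that keeps k. If m
    is in G, all its visits are after k, so t + 1 visits are enough.

    When no removal is possible, a cyclic class of G(A) with n nodes is thus
    visited at most (t + 1) n - t times, as it contains at least t nodes of a
    cycle of G. Write d = gamma q + r with r < gamma. A walk with more than
    sigma (q - 1) + gamma q + r nodes would visit each class at least
    (t + 1) q - t times, and the first r + 1 of them once more; the classes
    would then have at least q nodes, r + 1 of them at least q + 1, and there
    would be at least d + 1 nodes. *)
From Stdlib Require Import Relation_Operators Classical.
Require Import Defs.
From mathcomp Require Import all_boot all_order all_algebra.
From mathcomp Require Import reals constructive_ereal.
From mathcomp Require Import zify.

(** * Closed walks and cyclicity *)

Lemma not_uniq_split {T : eqType} (s : seq T) :
  ~~ uniq s -> exists x s1 s2 s3, s = s1 ++ x :: s2 ++ x :: s3.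
Proof.
elim: s => //= x s IHs; rewrite negb_and negbK => /orP[xs|/IHs].
  by case/splitPr: xs => s2 s3; exists x, [::], s2, s3.
by case=> y [s1 [s2 [s3 ->]]]; exists y, (x :: s1), s2, s3.
Qed.

(** Induction on the length of [c]: a repeated node [x] splits off an inner closed walk at [x]; this
    part and what remains of [c] are both shorter closed walks. *)
Lemma removal_closed {V : finType} (D : digraph V) (i : V) (p1 c p2 : seq V) :
  path (arcs D) (last i p1) c -> last (last i p1) c = last i p1 ->
  clos_refl_trans _ (cycle_removal D i) (p1 ++ c ++ p2) (p1 ++ p2).
Proof.
have [n] := ubnP (size c); elim: n p1 c p2 => // n IHn p1 c p2 szc Pc Lc.
have [Uc|/not_uniq_split[x [c1 [c2 [c3 Ec]]]]] := boolP (uniq c).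
  have [->|c0] := altP (c =P [::]); first exact: rt_refl.
  apply: rt_step; exists p1, c, p2; split=> //.
  rewrite /is_cycle /is_walk Pc Lc eqxx c0 Uc !andbT.
  by case: c Pc c0 {szc Lc Uc} => //= y c /andP[/arcs_nodes/andP[]].
rewrite -!cat_rcons in Ec.
have E1 : p1 ++ c ++ p2 = (p1 ++ rcons c1 x) ++ rcons c2 x ++ (c3 ++ p2).
  by rewrite Ec -!catA.
have E2 : (p1 ++ rcons c1 x) ++ c3 ++ p2 = p1 ++ (rcons c1 x ++ c3) ++ p2.
  by rewrite !catA.
move: szc Pc Lc; rewrite E1 Ec.
rewrite !size_cat !size_rcons !cat_path !last_cat !last_rcons.
move=> szc /and3P[P1 P2 P3] L3.
apply: (@rt_trans _ _ _ ((p1 ++ rcons c1 x) ++ c3 ++ p2)).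
  by apply: IHn; rewrite ?last_cat ?last_rcons ?size_rcons //; lia.
rewrite E2; apply: IHn; rewrite ?size_cat ?size_rcons ?cat_path ?last_cat.
- lia.
- by rewrite P1 last_rcons.
- by rewrite last_rcons.
Qed.

Lemma closed_walk_dvdn {V : finType} (D : digraph V) (x : V) (c : seq V) :
  path (arcs D) x c -> last x c = x -> cyclicity D %| size c.
Proof.
move=> Pc Lc; have := removal_closed D x [::] c [::] Pc Lc.
(* The empty walk becomes a variable [e] so that induction on the closure applies; divisibility is
   carried from [e] back to [c], one removed cycle at a time. *)
rewrite /= cats0; move Ee: [::] => e rm; have: size e = 0 by rewrite -Ee.
move=> e0; suff: (cyclicity D %| size e) -> (cyclicity D %| size c).
  by rewrite e0; apply.
elim: rm {Ee e0 Pc Lc} => [p q [p1 [b [p2 [-> cb ->]]]]|//|p q r _ h1 _ h2].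
- rewrite !size_cat => hq; rewrite addnCA; apply: dvdn_add => //.
  by move/cyclicityP: (dvdnn (cyclicity D)) => /(_ _ _ cb).
- by move=> /h2/h1.
Qed.

(** The class of [x] is the length of a chosen walk from [i] to [x]. For an arc from [x] to [y], one
    return walk from [y] to [i] closes both the walk chosen for [y] and the one through [x], so
    their lengths agree modulo the cyclicity. *)
Lemma cyclic_classes {V : finType} (D : digraph V) (i : V) :
  0 < cyclicity D -> (forall x y, connect (arcs D) x y) ->
  exists cl : V -> nat,
    cl i = 0 /\
    (forall x y, arcs D x y -> cl y = (cl x).+1 %[mod cyclicity D]).
Proof.
set g := cyclicity D => g0 conn.
have walkP x : exists p, path (arcs D) i p && (last i p == x).
  by have /connectP[p Pp ->] := conn i x; exists p; rewrite Pp eqxx.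
pose w x := xchoose (walkP x).
have wP x : path (arcs D) i (w x) by have /andP[] := xchooseP (walkP x).
have wL x : last i (w x) = x by have /andP[_ /eqP] := xchooseP (walkP x).
exists (fun x => size (w x) %% g); split=> [|x y xy].
  exact/eqP/(closed_walk_dvdn D i).
have /connectP[r Pr Er] := conn y i.
have d1 : g %| size (w y) + size r.
  rewrite -size_cat; apply: (closed_walk_dvdn D i).
    by rewrite cat_path wP wL.
  by rewrite last_cat wL -Er.
have d2 : g %| (size (w x)).+1 + size r.
  rewrite addSnnS -[_.+1]/(size (y :: r)) -size_cat.
  apply: (closed_walk_dvdn D i); rewrite ?cat_path ?last_cat wL /=.
    by rewrite wP xy Pr.
  by rewrite -Er.
rewrite modn_mod -addn1 modnDml addn1; apply/eqP.
by rewrite -(eqn_modDr (size r)) (eqP d1) (eqP d2).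
Qed.

(** * Pigeonhole principle and splitting of sequences *)

(** Residues modulo [t * g] that agree modulo [g] differ only in their quotient by [g], which takes
    at most [t] values. *)
Lemma pigeonhole_mod (g t : nat) (s : seq nat) :
  0 < g -> 0 < t -> {in s &, forall a b, a = b %[mod g]} -> t < size s ->
  exists x y, [/\ x < y, y < size s & nth 0 s x = nth 0 s y %[mod t * g]].
Proof.
move=> g0 t0 sg ts; pose f z := z %% (t * g) %/ g.
have: ~~ uniq (map f s).
  apply/negP=> Us; suff: size (map f s) <= size (iota 0 t).
    by rewrite size_map size_iota leqNgt ts.
  apply: uniq_leq_size => // _ /mapP[z _ ->].
  by rewrite mem_iota /= ltn_divLR // ltn_mod muln_gt0 t0.
move/(uniqPn 0) => [x [y [xy]]]; rewrite size_map => ys.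
have xs := ltn_trans xy ys; rewrite !(nth_map 0) // => Ef.
exists x, y; split=> //; have mod_g z : z %% (t * g) %% g = z %% g.
  by rewrite modn_dvdm ?dvdn_mull.
rewrite (divn_eq (nth 0 s x %% _) g) (divn_eq (nth 0 s y %% _) g) -!/(f _) Ef.
by rewrite !mod_g (sg _ _ (mem_nth 0 xs) (mem_nth 0 ys)).
Qed.

Lemma count_nth_iota {T : Type} (a : pred T) (x : T) (s : seq T) :
  count a s = count (fun k => a (nth x s k)) (iota 0 (size s)).
Proof. by rewrite -{1}(mkseq_nth x s) count_map. Qed.

Lemma last_take {T : Type} (x : T) (s : seq T) (k : nat) :
  k <= size s -> last x (take k s) = nth x (x :: s) k.
Proof.
by case: k => [|k] ks; rewrite ?take0 // (last_nth x) size_takel //= nth_take.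
Qed.

Lemma split_first {T : Type} (a : pred T) (i : T) (p : seq T) :
  has a (i :: p) ->
  exists p1 p2, [/\ p = p1 ++ p2, a (last i p1) & ~~ has a (belast i p1)].
Proof.
elim: p i => [|y p IHp] i.
  by rewrite has_seq1 => ai; exists [::], [::].
have [ai _|nai] := boolP (a i); first by exists [::], (y :: p).
rewrite /= (negPf nai) => /IHp[p1 [p2 [-> al nab]]].
by exists (y :: p1), p2; rewrite /= negb_or nai.
Qed.

Lemma split_last {T : Type} (a : pred T) (i : T) (p : seq T) :
  has a (i :: p) ->
  exists p1 p2, [/\ p = p1 ++ p2, a (last i p1) & ~~ has a p2].
Proof.
elim: p i => [|y p IHp] i.
  by rewrite has_seq1 => ai; exists [::], [::].
have [hp _|nhp] := boolP (has a (y :: p)).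
  by have [p1 [p2 [-> al na]]] := IHp y hp; exists (y :: p1), p2.
rewrite -[has _ _]/(a i || has a (y :: p)) (negPf nhp) orbF => ai.
by exists [::], (y :: p).
Qed.

Lemma cat_eq_cat {T : Type} (s1 s2 x z : seq T) :
  s1 ++ s2 = x ++ z -> size s1 <= size x ->
  exists w, x = s1 ++ w /\ s2 = w ++ z.
Proof.
elim: s1 x => [|a s1 IHs] [|b x] //=; first by exists [::].
  by exists (b :: x).
by case=> -> /IHs{}IHs /IHs[w [-> ->]]; exists w.
Qed.

Lemma cut_walk {V : finType} (D : digraph V) (i : V) (x c y : seq V) :
  path (arcs D) i (x ++ c ++ y) -> last (last i x) c = last i x ->
  [/\ clos_refl_trans _ (cycle_removal D i) (x ++ c ++ y) (x ++ y),
      path (arcs D) i (x ++ y) & last i (x ++ y) = last i (x ++ c ++ y)].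
Proof.
rewrite !cat_path !last_cat => /and3P[Px Pc Py] Lc.
by split; [exact: removal_closed|rewrite Px -{1}Lc|rewrite Lc].
Qed.

(** * Removing closed walks between visits to a node *)

Section CyclicClasses.

Context {V : finType} (D : digraph V) (g : nat) (cl : V -> nat).
Hypothesis g_gt0 : 0 < g.
Hypothesis cl_arc : forall x y, arcs D x y -> cl y = (cl x).+1 %[mod g].

Lemma cl_last (x : V) (p : seq V) :
  path (arcs D) x p -> cl (last x p) = cl x + size p %[mod g].
Proof.
elim: p x => [|y p IHp] x /=; first by rewrite addn0.
by case/andP=> /cl_arc xy /IHp ->; rewrite addnS -addSn -modnDml xy modnDml.
Qed.

Lemma cl_nth (x : V) (p : seq V) (k : nat) :
  path (arcs D) x p -> k <= size p ->
  cl (nth x (x :: p) k) = cl x + k %[mod g].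
Proof.
move=> Pp kp; rewrite -last_take // cl_last ?size_takel //.
by move: Pp; rewrite -{1}(cat_take_drop k p) cat_path => /andP[].
Qed.

(** The indices of the visits to [m] agree modulo [g], since an index and [cl i] determine the
    class; the pigeonhole then yields two that agree modulo [t * g]. *)
Lemma repeated_node (t : nat) (m i : V) (p : seq V) :
  0 < t -> path (arcs D) i p -> t < count_mem m (i :: p) ->
  exists x c y, [/\ p = x ++ c ++ y, c != [::], last i x = m, last m c = m
                  & t * g %| size c].
Proof.
move=> t0 Pp; rewrite (count_nth_iota _ i) -size_filter.
set S := filter _ _ => tS.
have S_P k : k \in S -> k <= size p /\ nth i (i :: p) k = m.
  by rewrite mem_filter mem_iota /= add0n ltnS => /andP[/eqP -> ->].
have Sg : {in S &, forall a b, a = b %[mod g]}.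
  move=> a b /S_P[ap am] /S_P[bp bm]; apply/eqP.
  by rewrite -(eqn_modDl (cl i)) -!(cl_nth _ p) // am bm.
have [x [y [xy yS Exy]]] := pigeonhole_mod g t S g_gt0 t0 Sg tS.
have xS := ltn_trans xy yS.
move: (mem_nth 0 xS) (mem_nth 0 yS) Exy.
have Ssort : sorted ltn S.
  by apply: sorted_filter (iota_ltn_sorted _ _); exact: ltn_trans.
have: nth 0 S x < nth 0 S y by apply: (sorted_ltn_nth ltn_trans).
set a := nth 0 S x; set b := nth 0 S y => ab /S_P[ap am] /S_P[bp bm] Eab.
have Et : take b p = take a p ++ drop a (take b p).
  by rewrite -{1}(cat_take_drop a (take b p)) take_takel ?(ltnW ab).
exists (take a p), (drop a (take b p)), (drop b p); split.
- by rewrite catA -Et cat_take_drop.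
- by rewrite -size_eq0 size_drop size_takel // subn_eq0 -ltnNge.
- by rewrite last_take.
- by have := last_take i p b bp; rewrite bm {1}Et last_cat last_take // am.
- by rewrite size_drop size_takel // -eqn_mod_dvd ?(ltnW ab) // Eab.
Qed.

(* The b-th visit to the class at offset rho has index rho + g * (b - 1); the
   second hypothesis says that it exists, also covering b = 0. *)
Lemma class_count (i : V) (p : seq V) (rho b : nat) :
  path (arcs D) i p -> rho + g * b <= g + size p ->
  b <= count (fun m => cl m == cl i + rho %[mod g]) (i :: p).
Proof.
move=> Pp bp; rewrite (count_nth_iota _ i) -size_filter.
rewrite -{1}(size_iota 0 b) -(size_map (fun k => rho + g * k)).
apply: uniq_leq_size.
  rewrite map_inj_uniq ?iota_uniq // => k l /addnI/eqP.
  by rewrite eqn_pmul2l // => /eqP.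
move=> _ /mapP[k + ->]; rewrite mem_iota => /andP[_]; rewrite add0n => kb.
have kp : rho + g * k <= size p by move: bp; nia.
rewrite mem_filter mem_iota add0n /= ltnS kp andbT /= (cl_nth _ p) //.
by rewrite addnA (addnC _ (g * k)) mulnC modnMDl.
Qed.

(* The parts [p1a] and [p2b] glued at [m] in the last case are those before the
   last visit to [m] ahead of [k] and after the first visit to [m] behind [k];
   the removed closed walk [c] may straddle the gluing point, and then splits
   into two closed walks at [m], one on each side of [k]. *)
Lemma shorten_walk (G : digraph V) (t : nat) (m i : V) (p : seq V) :
  0 < t -> path (arcs D) i p -> goes_through G i p ->
  t + (m \notin nodes G) < count_mem m (i :: p) ->
  exists q, [/\ clos_refl_trans _ (cycle_removal D i) p q,
                path (arcs D) i q /\ last i q = last i p,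
                goes_through G i q, size q = size p %[mod t * g]
              & size q < size p].
Proof.
move=> t0 Pp Gp tm.
(* [n] is the total length removed, possibly in two pieces; [r] is the part of the new walk that
   ends at the preserved node of [G]. *)
suff [n [r [r' [Gr [Rq Pq Lq] [n0 dn sn]]]]] : exists n r r',
    [/\ last i r \in nodes G,
        [/\ clos_refl_trans _ (cycle_removal D i) p (r ++ r'),
            path (arcs D) i (r ++ r') & last i (r ++ r') = last i p]
      & [/\ 0 < n, t * g %| n & size p = n + size (r ++ r')]].
  exists (r ++ r'); split=> //.
  - by apply/hasP; exists (last i r) => //; rewrite -cat_cons mem_cat mem_last.
  - by rewrite sn -modnDml (eqP dn) add0n.
  - by rewrite sn -[ltnLHS]add0n ltn_add2r.
have size_neq0 (c : seq V) : c != [::] -> 0 < size c by rewrite -size_eq0 lt0n.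
have [p1 [p2 [Ep Gk nG]]] := split_first _ _ _ Gp.
set k := last i p1 in Gk; move: Pp tm; rewrite Ep => Pp.
have [P1 P2] : path (arcs D) i p1 /\ path (arcs D) k p2.
  by apply/andP; rewrite -cat_path.
rewrite -cat_cons lastI -/k cat_rcons count_cat => tm.
(* If [m] does not occur before [k], all its visits belong to the walk [p2] from [k], and cutting
   there keeps [k]. *)
have [m1|m1] := boolP (m \in belast i p1); last first.
  rewrite (count_memPn m1) add0n in tm.
  have [|x [c [y [E2 c0 Lx Lc dc]]]] := repeated_node t m k p2 t0 P2.
    by apply: leq_ltn_trans tm; exact: leq_addr.
  have E3 : p1 ++ p2 = (p1 ++ x) ++ c ++ y by rewrite E2 -!catA.
  have [||R' P' L'] := cut_walk D i (p1 ++ x) c y.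
  - by rewrite -E3.
  - by rewrite last_cat -/k Lx.
  exists (size c), p1, (x ++ y); rewrite (catA p1 x y) E3; split=> //.
  split=> //; first exact: size_neq0.
  by rewrite !size_cat; clear; lia.
have mG : m \notin nodes G by apply: contra nG => mG; apply/hasP; exists m.
have mk : k != m by apply: contraNneq mG => <-.
rewrite mG addn1 /= (negPf mk) add0n in tm.
have [m2|m2] := boolP (m \in p2); last first.
  rewrite (count_memPn m2) addn0 in tm.
  have [|x [c [y [E2 c0 Lx Lc dc]]]] := repeated_node t m i p1 t0 P1.
    by rewrite lastI -cats1 count_cat (leq_trans _ (leq_addr _ _)) // ltnW.
  have E3 : p1 ++ p2 = x ++ c ++ (y ++ p2) by rewrite E2 -!catA.
  have [||R' P' L'] := cut_walk D i x c (y ++ p2).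
  - by rewrite -E3.
  - by rewrite Lx.
  exists (size c), (x ++ y), p2; rewrite -!catA E3; split=> //.
    by move: Gk; rewrite /k E2 !last_cat Lx Lc.
  split=> //; first exact: size_neq0.
  by rewrite !size_cat; clear; lia.
have [|p1a [p1b [E1 /eqP L1 N1]]] := split_last (pred1 m) i p1.
  by rewrite has_pred1 lastI mem_rcons inE m1 orbT.
have [|p2a [p2b [E2 /eqP L2 N2]]] := split_first (pred1 m) k p2.
  by rewrite has_pred1 inE m2 orbT.
have PZ : path (arcs D) i (p1a ++ p2b).
  by move: P1 P2; rewrite E1 E2 !cat_path L1 L2 => /andP[-> _] /andP[_ ->].
(* Gluing merges two visits into one, so at least [t + 1] of the [t + 2] visits remain. *)
have tZ : t < count_mem m (i :: p1a ++ p2b).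
  have C1 : count_mem m (belast i p1) = count_mem m (i :: p1a).
    have := congr1 (count_mem m) (lastI i p1).
    rewrite {1}E1 -cat_cons -cats1 !count_cat -/k /= (negPf mk) !addn0 => <-.
    by move: N1; rewrite has_count -leqNgt leqn0 => /eqP ->; rewrite addn0.
  have C2 : count_mem m p2 = (count_mem m p2b).+1.
    have := congr1 (count_mem m) (lastI k p2a).
    rewrite -cats1 count_cat /= (negPf mk) add0n L2 eqxx => C2.
    rewrite E2 count_cat C2 /=.
    by move: N2; rewrite has_count -leqNgt leqn0 => /eqP ->.
  by move: tm; rewrite C1 C2 -cat_cons count_cat addnS ltnS.
have [x [c [y [EZ c0 Lx Lc dc]]]] := repeated_node t m i _ t0 PZ tZ.
have sc := size_neq0 c c0.
have Ep2 : p1 ++ p2 = p1a ++ p1b ++ p2a ++ p2b by rewrite E1 E2 -!catA.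
have Lk : last m p1b = k by rewrite /k E1 last_cat L1.
(* Here [c] starts at or after the gluing point, so it lies in [p2b]; otherwise it straddles that
   point or lies in [p1a]. *)
have [le_ax|lt_xa] := leqP (size p1a) (size x).
  have [x' [Ex Eb]] := cat_eq_cat p1a p2b x (c ++ y) EZ le_ax.
  have Lx' : last m x' = m by move: Lx; rewrite Ex last_cat L1.
  have [||R' P' L'] := cut_walk D i (p1 ++ p2a ++ x') c y.
  - by rewrite -!catA -Eb -E2.
  - by rewrite !last_cat -/k L2 Lx'.
  exists (size c), p1, (p2a ++ x' ++ y); move: R' P' L'.
  rewrite -!catA -Eb -E2 => R' P' L'; split=> //; split=> //.
  by rewrite E2 Eb !size_cat; clear; lia.
have [w [Ea Ew]] := cat_eq_cat x (c ++ y) p1a p2b (esym EZ) (ltnW lt_xa).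
have Lw : last m w = m by rewrite -{1}Lx -last_cat -Ea.
have [le_wc|lt_cw] := leqP (size w) (size c).
  have [c2 [Ec Eb]] := cat_eq_cat w p2b c y (esym Ew) le_wc.
  have Lc2 : last m c2 = m by move: Lc; rewrite Ec last_cat Lw.
  have [||R' P' L'] := cut_walk D i (p1 ++ p2a) c2 y.
  - by rewrite -!catA -Eb -E2.
  - by rewrite !last_cat -/k L2.
  (* Only the sum of the lengths of [w] and [c2] is known to be divisible by [t * g], so both pieces
     are cut. *)
  have [||R'' P'' L''] := cut_walk D i x w (p1b ++ p2a ++ y).
  - by move: P'; rewrite E1 Ea -!catA.
  - by rewrite Lx.
  have Eq1 : p1 ++ p2 = (p1 ++ p2a) ++ c2 ++ y by rewrite E2 Eb -!catA.
  have Eq2 : (p1 ++ p2a) ++ y = x ++ w ++ p1b ++ p2a ++ y.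
    by rewrite E1 Ea -!catA.
  exists (size c), (x ++ p1b), (p2a ++ y); rewrite -(catA x) Eq1.
  split; first by rewrite last_cat Lx Lk.
    split=> //; last by rewrite L'' -Eq2 L'.
    by apply: rt_trans R' _; rewrite Eq2.
  by split=> //; rewrite E1 Ea Ec !size_cat; clear; lia.
have [y' [Ec Ey]] := cat_eq_cat c y w p2b Ew (ltnW lt_cw).
have Ep3 : p1 ++ p2 = x ++ c ++ y' ++ p1b ++ p2 by rewrite E1 Ea Ec -!catA.
have [||R' P' L'] := cut_walk D i x c (y' ++ p1b ++ p2).
- by rewrite -Ep3.
- by rewrite Lx.
exists (size c), (x ++ y' ++ p1b), p2; rewrite -!catA Ep3.
have Ly : last m y' = m by move: Lw; rewrite Ec last_cat Lc.
split=> //; first by rewrite !last_cat Lx Ly Lk.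
by split=> //; rewrite !size_cat; clear; lia.
Qed.

End CyclicClasses.

(** * Counting the visits of a long walk *)

Lemma count_sum_mem {V : finType} (a : pred V) (s : seq V) :
  count a s = \sum_(m | a m) count_mem m s.
Proof.
elim: s => [|x s IHs] /=; first by rewrite big1.
rewrite big_split /= -IHs; congr (_ + _); rewrite big_mkcond (bigD1 x) //= eqxx.
rewrite big1 ?addn0; first by case: (a x).
by move=> m /negPf; rewrite eq_sym => ->; case: ifP.
Qed.

Lemma sum_ord_leq (g r : nat) : r < g -> \sum_(k < g) (k <= r) = r.+1.
Proof.
move=> rg; have -> : r.+1 = minn g r.+1 by lia.
elim: g {rg} => [|g IHg]; first by rewrite big_ord0 min0n.
by rewrite big_ord_recr /= IHg; case: leqP; lia.
Qed.

Lemma long_walk_visits {V : finType} (D G : digraph V) (g t : nat)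
    (cl : V -> nat) (i x : V) (p c : seq V) :
  0 < g -> 0 < t -> subrel (arcs G) (arcs D) ->
  is_cycle G x c -> t * g %| size c ->
  cl i = 0 ->
  (forall u v, arcs D u v -> cl v = (cl u).+1 %[mod g]) ->
  path (arcs D) i p -> t * g * (#|V| %/ g) + #|V| <= t * g + size p ->
  exists m, t + (m \notin nodes G) < count_mem m (i :: p).
Proof.
move=> g0 t0 GD Gc dc cli clD Pp long.
have [/existsP//|/existsPn few] :=
  boolP [exists m, t + (m \notin nodes G) < count_mem m (i :: p)].
case/and3P: Gc => /and3P[_ Pc _] c0 Uc.
have le_c : t * g <= size c by apply: dvdn_leq dc; rewrite lt0n size_eq0.
have cG : {subset c <= nodes G}.
  elim: c x Pc {Uc dc c0 le_c} => //= y c IHc x /andP[xy Pc] z.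
  rewrite inE => /predU1P[->|]; last exact: IHc Pc z.
  by have /andP[] := arcs_nodes xy.
have cD : path (arcs D) x c := sub_path GD Pc.
(* The cycle [c] has at least [t * g] distinct nodes, hence [g <= #|V|]; this makes the predecessor
   in [b] below a true one. *)
have q0 : 0 < #|V| %/ g.
  rewrite divn_gt0 // (leq_trans (leq_pmull g t0)) // (leq_trans le_c) //.
  by rewrite -(card_uniqP Uc) max_card.
pose a k := [pred m | cl m == k %[mod g]].
have cycle_count k : t <= count (a k) c.
  case: c c0 le_c cD {dc Pc Uc cG} => // y c _ le_c /andP[_ Py].
  (* The offset of class [k] from the class of [y], the first node listed in [c]. *)
  pose k' := (k + (g - cl y %% g)) %% g.
  have : t <= count (fun m => cl m == cl y + k' %[mod g]) (y :: c).
    apply: (class_count D) => //; have := ltn_pmod (k + (g - cl y %% g)) g0.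
    by rewrite -/k' => k'g; move: le_c => /=; rewrite mulnC; lia.
  rewrite (eq_count (a2 := a k)) // => m /=.
  rewrite modnDmr -modnDml addnCA subnKC ?modnDr //.
  by rewrite ltnW ?ltn_mod.
have class_size k :
    k < g -> #|V| %/ g + (k <= #|V| %% g) <= \sum_(m | a k m) 1.
  move=> kg; set n := \sum_(m | _) _.
  pose b := t * (#|V| %/ g).-1 + #|V| %/ g + (k <= #|V| %% g).
  have b_le : b <= count (a k) (i :: p).
    have := class_count D g cl g0 clD i p k b Pp; rewrite cli add0n; apply.
    rewrite /b; have := divn_eq #|V| g; move: long q0.
    case: (#|V| %/ g) => // q; rewrite mulnS /= => long _ VE.
    have -> : g * (t * q + q.+1 + (k <= #|V| %% g)) =
        t * g * q + q.+1 * g + g * (k <= #|V| %% g).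
      by rewrite !mulnDr mulnCA mulnA (mulnC g q.+1).
    by case: leqP long kg VE; rewrite ?muln1 ?muln0; clear; lia.
  (* Each node of the class contributes [t + 1]: the share [t + (m \notin nodes G)] bounds its
     visits by the walk, the share [(m \in nodes G)] its single possible occurrence in [c]. *)
  have : b + t <= t.+1 * n.
    rewrite /n big_distrr /=; under eq_bigr do rewrite muln1 -addn1.
    have -> : \sum_(m | a k m) (t + 1) =
        \sum_(m | a k m) (t + (m \notin nodes G)) +
        \sum_(m | a k m) (m \in nodes G).
      rewrite -big_split; apply: eq_bigr => m _ /=.
      by rewrite -addnA; case: (m \in _).
    apply: leq_add.
      rewrite (leq_trans b_le) // count_sum_mem leq_sum // => m _.
      by rewrite leqNgt few.
    rewrite (leq_trans (cycle_count k)) // count_sum_mem leq_sum // => m _.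
    rewrite count_uniq_mem //; case: (boolP (m \in c)) => // /cG -> //.
  (* With [Q = #|V| %/ g], [b + t] is [t.+1 * Q] plus the indicator, so an indicator of 1 already
     forces [n > Q]. *)
  rewrite /b; case: (#|V| %/ g) q0 => // q _ /= le_bt.
  rewrite addSn ltnNge; apply/negP => le_nq.
  have := leq_mul (leqnn t.+1) le_nq; rewrite mulnDr (mulSn t q).
  move/(leq_trans le_bt); case: (k <= _); rewrite /= ?muln1 ?muln0; clear; lia.
(* The classes partition [V], yet the lower bounds on their sizes add up to [#|V| + 1]. *)
have : \sum_(k < g) (#|V| %/ g + (k <= #|V| %% g)) <= #|V|.
  rewrite -[leqRHS]sum1_card.
  rewrite (partition_big (fun m => Ordinal (ltn_pmod (cl m) g0)) xpredT) //=.
  apply: leq_sum => k _; apply: leq_trans (class_size k (ltn_ord k)) _.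
  rewrite leq_eqVlt; apply/orP; left; apply/eqP/eq_bigl => m /=.
  by rewrite -val_eqE /= (modn_small (ltn_ord k)).
rewrite big_split /= sum_nat_const card_ord sum_ord_leq ?ltn_mod // addnS mulnC.
by rewrite -divn_eq ltnn.
Qed.

(** * Reduction to short walks and the threshold *)

(** [P] is an arbitrary proposition on integers, so the descent to a least element uses excluded
    middle. *)
Lemma ex_least (P : nat -> Prop) (n : nat) :
  P n -> exists m, [/\ m <= n, P m & forall k, P k -> m <= k].
Proof.
have [N] := ubnP n; elim: N n => // N IHN n nN Pn.
have [[k [kn Pk]]|nk] := classic (exists k, k < n /\ P k).
  have [m [mk Pm Hm]] := IHN k (leq_trans kn nN) Pk.
  by exists m; split=> //; exact: leq_trans mk (ltnW kn).
exists n; split=> // k Pk; rewrite leqNgt; apply/negP => kn.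
by apply: nk; exists k.
Qed.

(** Iterates [shorten_walk] as long as [long_walk_visits] supplies a node visited often enough; the
    length drops each time. *)
Lemma reduce_walk {V : finType} (D G : digraph V) (i x : V) (p c : seq V) :
  (forall u v, connect (arcs D) u v) -> subrel (arcs G) (arcs D) ->
  is_cycle G x c -> is_cycle D x c -> cyclicity D %| cyclicity G ->
  path (arcs D) i p -> goes_through G i p ->
  exists q, [/\ clos_refl_trans _ (cycle_removal D i) p q,
                path (arcs D) i q /\ last i q = last i p,
                goes_through G i q, size q = size p %[mod cyclicity G]
              & size q <
                cyclicity G * (#|V| %/ cyclicity D) + #|V| - cyclicity G].
Proof.
move=> Dconn GD Gc Dc dDG; have dG : cyclicity G %| size c.
  by move/cyclicityP: (dvdnn (cyclicity G)) => /(_ _ _ Gc).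
have sc : 0 < size c by case/and3P: Gc => _; case: (c).
have G0 : 0 < cyclicity G := dvdn_gt0 sc dG.
have D0 : 0 < cyclicity D := dvdn_gt0 G0 dDG.
have [cl [cli clD]] := cyclic_classes D i D0 Dconn.
have /dvdnP[t tE] := dDG.
have t0 : 0 < t by move: G0; rewrite tE; case: (t).
have [n] := ubnP (size p); elim: n p => // n IHn p ltn Pp Gp.
have [small|big] := ltnP (size p)
    (cyclicity G * (#|V| %/ cyclicity D) + #|V| - cyclicity G).
  by exists p; split=> //; exact: rt_refl.
have [||m few] := long_walk_visits D G (cyclicity D) t cl i x p c
    D0 t0 GD Gc _ cli clD Pp.
- by rewrite -tE.
- by rewrite -tE -leq_subLR.
have [q [Rq [Pq Lq] Gq]] :=
  shorten_walk D (cyclicity D) cl D0 clD G t m i p t0 Pp Gp few.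
rewrite -tE => Eq lt_qp.
have [r [Rr [Pr Lr] Gr Er ltr]] := IHn q (leq_trans lt_qp ltn) Pq Gq.
exists r; split=> //; first exact: rt_trans Rq Rr.
  by rewrite Lr.
by rewrite Er.
Qed.

Theorem proposition4p5 (R : realType) (d : nat) (A : 'M[Rmax R]_d)
    (G : digraph 'I_d) (gamma sigma : nat)
    (A_irr : irreducible A)
    (G_sub : subgraph G (mx_digraph A))
    (G_sc : strongly_connected G)
    (G_cycle : exists i p, is_cycle G i p)
    (gammaE : gamma = cyclicity (mx_digraph A))
    (sigmaE : sigma = cyclicity G) :
  exists T : nat,
    is_cycle_removal_threshold sigma A G T /\
    (T%:Z <= sigma%:Z * (d %/ gamma)%N%:Z + d%:Z - sigma%:Z - 1)%R.
Proof.
case: G_cycle => x [c Gc]; case: G_sub => _ GD.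
have cycleD y q : is_cycle G y q -> is_cycle (mx_digraph A) y q.
  case/and3P=> /and3P[_ Pq Lq] q0 Uq.
  by rewrite /is_cycle /is_walk inE (sub_path GD Pq) Lq q0.
have dvd_gs : gamma %| sigma.
  rewrite gammaE sigmaE; apply/cyclicityP => y q /cycleD Dq.
  by move/cyclicityP: (dvdnn (cyclicity (mx_digraph A))) => /(_ _ _ Dq).
have conn u v : connect (arcs (mx_digraph A)) u v by apply: A_irr; rewrite inE.
(* [N] is the claimed bound plus one, with truncated subtraction. *)
pose N := sigma * (d %/ gamma) + d - sigma.
have bound i p : path (arcs (mx_digraph A)) i p -> goes_through G i p ->
    exists q, [/\ clos_refl_trans _ (cycle_removal (mx_digraph A) i) p q,
                  path (arcs (mx_digraph A)) i q /\ last i q = last i p,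
                  goes_through G i q, size q = size p %[mod sigma]
                & size q < N].
  move=> Pp Gp; rewrite /N gammaE sigmaE.
  rewrite -[d in d %/ _]card_ord -[d in _ + d]card_ord.
  apply: (@reduce_walk _ _ _ i x p c) => //; first exact: cycleD.
  by rewrite -gammaE -sigmaE.
have xG : x \in nodes G by case/and3P: Gc => /and3P[].
(* Reducing the empty walk at [x] gives a length below [N]. Positivity makes both the subtraction in
   [N] and the predecessor [N.-1] exact. *)
have N0 : 0 < N.
  have [||q [_ _ _ _]] := bound x [::] => //.
    by rewrite /goes_through /= xG.
  exact: leq_ltn_trans.
have [|T [leT PT minT]] := @ex_least (cycle_removal_bound sigma A G) N.-1.
  move=> i j p /and3P[_ Pp /eqP Lp] Gp _.
  have [q [Rq [Pq Lq] Gq Eq ltq]] := bound i p Pp Gp.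
  exists q; split=> //; last by rewrite -ltnS prednK.
    by rewrite /is_walk inE Pq Lq Lp eqxx.
  (* No cycle of [G] is inserted. *)
  by exists q; split=> //; exact: rt_refl.
exists T; split; first by split.
move: N0 leT; rewrite /N -PoszM; move: (sigma * _) => M; lia.
Qed.
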